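(* Let $\mathcal{G}=(\mathcal{V},\mathcal{E})$ be a finite directed graph with positive edge weights and source set $S$, satisfying Assumption A1, and let $D(\cdot)$ be generated by the asynchronous adaptive Bellman--Ford algorithm from an arbitrary initial state $D(0)$, with event sequences and execution queues satisfying Assumption A2. Then the underestimate error satisfies $$\Delta^-(t)=0\qquad\text{for all } t\ge T_P^- := P\left\lceil\frac{d^*_{\max}-D^{\min}(0)}{e_{\min}}\right\rceil,$$ with the convention $\lceil-\infty\rceil=-\infty$ (so if $D^{\min}(0)=\infty$ the conclusion holds for all $t\ge 0$).
   Context: Graph and distances. $\mathcal{G}=(\mathcal{V},\mathcal{E})$ is a finite directed graph with weights $e_{ij}>0$ for $(i,j)\in\mathcal{E}$, and $e_{\min}=\min_{(i,j)\in\mathcal{E}}e_{ij}$; $S\subset\mathcal{V}$ (proper subset) is the source set; $\mathcal{N}(i)=\{j:(i,j)\in\mathcal{E}\}$. Assumption A1: from each $i\in\mathcal{V}$ there is a directed path to $S$. $d_i^*$ is the minimum of $\sum_{(v,v')\in\mathcal{P}}e_{vv'}$ over directed paths $\mathcal{P}$ from $i$ to a vertex of $S$ ($d_i^*=0$ for $i\in S$), and $d^*_{\max}=\max_{i\in\mathcal{V}}d_i^*$. Algorithm. The state at time $t\in\{0,1,2,\dots\}$ is $D(t)=[\{d_i(t)\}_{i\in\mathcal{V}},\{m_{ij}(t)\}_{(i,j)\in\mathcal{E}},\{d_{ij}(t)\}_{(i,j)\in\mathcal{E}}]$, with entries in $\mathbb{R}\cup\{+\infty\}$. The possible actions are: Read$(i,j)$: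 $d_{ij}\leftarrow m_{ij}$; Update$(i)$: $d_i\leftarrow \min_{j\in\mathcal{N}(i)}(d_{ij}+e_{ij})$ if $i\notin S$, and $d_i\leftarrow 0$ if $i\in S$; Write$(i,j)$: $m_{ij}\leftarrow d_j$. $D(0)$ is the initial state. For each $t\ge1$ there are sets $\mathcal{R}(t)\subseteq\mathcal{E}$, $\mathcal{U}(t)\subseteq\mathcal{V}$, $\mathcal{W}(t)\subseteq\mathcal{E}$ and an execution queue $\mathcal{Q}(t)$, i.e. an ordered list containing exactly once each of Read$(i,j)$ for $(i,j)\in\mathcal{R}(t)$, Update$(i)$ for $i\in\mathcal{U}(t)$, Write$(i,j)$ for $(i,j)\in\mathcal{W}(t)$, in arbitrary order. $D(t)$ is obtained from $D(t-1)$ by executing the instructions of $\mathcal{Q}(t)$ sequentially. Assumption A2: there are integers $P_R\ge0$, $P_U\ge1$, $P_W\ge0$ such that for all $t\geq 1$: $\bigcup_{k=0}^{\max(0,P_R-1)}\mathcal{R}(t+k)=\mathcal{E}$, $\bigcup_{k=0}^{P_U-1}\mathcal{U}(t+k)=\mathcal{V}$, $\bigcup_{k=0}^{\max(0,P_W-1)}\mathcal{W}(t+k)=\mathcal{E}$. Convention: $P_W=0$ additionally means that in each queue all Writes come after all Updates and before all Reads; $P_R=0$ additionally means that in each queue all Reads come after all non-Read instructions. The asynchrony measure is $P:=P_R+P_U+P_W$. Errors. $D^*=[\{d_i^*\}_{i\in\mathcal{V}},\{d_j^*\}_{(i,j)\in\mathcal{E}},\{d_j^*\}_{(i,j)\in\mathcal{E}}]$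 is the vector of true values of $D$. $\Delta^-(t)$ is the maximum of $0$ and of all the numbers $d_i^*-d_i(t)$ ($i\in\mathcal{V}$), $d_j^*-m_{ij}(t)$ and $d_j^*-d_{ij}(t)$ ($(i,j)\in\mathcal{E}$). $D^{\min}(t)$ is the minimum of the entries $[D(t)]_k$ over all indices $k$ with $[D(t)]_k<D^*_k$, and $D^{\min}(t)=\infty$ if there is no such $k$. *)

(* Defs.v *)
From HB Require Import structures.
From mathcomp Require Import all_boot all_order all_algebra.
From mathcomp Require Import classical_sets reals constructive_ereal ereal.

Set Implicit Arguments.
Unset Strict Implicit.
Unset Printing Implicit Defensive.

Import Order.TTheory GRing.Theory Num.Theory.

Local Open Scope ring_scope.
Local Open Scope ereal_scope.

Section Graph.
Variables (R : realType) (V : finType).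
Variables (E : {set V * V}) (e : V * V -> R) (S : {set V}).

(* The path visits i, then the vertices of p in order; p = [::] is the trivial
   path at i, of weight 0, so that sources are at distance 0
   (see dist_source). *)
Definition dipath_to (i : V) (p : seq V) : bool :=
  path (fun u v => (u, v) \in E) i p && (last i p \in S).

(* zip (i :: p) p lists the arcs (v, v') traversed by the path. *)
Definition path_weight (i : V) (p : seq V) : R :=
  (\sum_(a <- zip (i :: p) p) e a)%R.

(* When some path exists this infimum is attained, see dist_min. *)
Definition dist (i : V) : \bar R :=
  ereal_inf [set (path_weight i p)%:E | p in [set p | dipath_to i p]]%classic.

Definition dist_max : \bar R := \big[maxe/-oo]_(i : V) dist i.

Definition weight_min : \bar R := \big[mine/+oo]_(a in E) (e a)%:E.

End Graph.

Section DistFacts.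
Variables (R : realType) (V : finType).
Variables (E : {set V * V}) (e : V * V -> R) (S : {set V}).
Hypothesis e_gt0 : forall a, a \in E -> (0 < e a)%R.

Local Notation dipath_to := (dipath_to E S).
Local Notation path_weight := (path_weight e).

Lemma path_weight_cons i j p :
  path_weight i (j :: p) = (e (i, j) + path_weight j p)%R.
Proof. by rewrite /path_weight /= big_cons. Qed.

Lemma path_weight_ge0 i p : dipath_to i p -> (0 <= path_weight i p)%R.
Proof.
elim: p i => [|j p IH] i; first by rewrite /path_weight /= big_nil.
rewrite /dipath_to /= -andbA => /and3P[ij jp lp]; rewrite path_weight_cons.
by rewrite addr_ge0 ?IH ?(ltW (e_gt0 ij)) // /dipath_to jp lp.
Qed.

Lemma dipath_suffix i x p : dipath_to x p -> i \in x :: p ->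
  exists q, [/\ dipath_to i q, (path_weight i q <= path_weight x p)%R &
    (uniq (x :: p) -> uniq (i :: q))].
Proof.
elim: p x => [|y p IH] x xp.
  by rewrite inE => /eqP ->; exists [::].
rewrite inE => /orP[/eqP ->|iyp]; first by exists (y :: p).
move: xp; rewrite /dipath_to /= -andbA => /and3P[xy yp lp].
have [|q [iq wq uq]] := IH y _ iyp; first by rewrite /dipath_to yp lp.
exists q; split=> // [|/andP[_ /uq//]].
rewrite path_weight_cons (le_trans wq)// lerDr.
exact: ltW (e_gt0 xy).
Qed.

Lemma dipath_uniq i p : dipath_to i p ->
  exists q, [/\ dipath_to i q, uniq (i :: q) &
    (path_weight i q <= path_weight i p)%R].
Proof.
elim: p i => [|j p IH] i ip; first by exists [::].
move: ip; rewrite /dipath_to /= -andbA => /and3P[ij jp lp].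
have [|q [jq uq wq]] := IH j; first by rewrite /dipath_to jp lp.
have wij : (e (i, j) + path_weight j q <= path_weight i (j :: p))%R.
  by rewrite path_weight_cons lerD2l.
have [ijq|ijq] := boolP (i \in j :: q).
  have [r [ir wr ur]] := dipath_suffix jq ijq.
  exists r; split; [by []|exact: ur|].
  apply: le_trans wr (le_trans _ wij); rewrite lerDr.
  exact: ltW (e_gt0 ij).
exists (j :: q); split; last by rewrite path_weight_cons.
- by move: jq; rewrite /dipath_to /= ij.
- by rewrite cons_uniq ijq.
Qed.

Lemma dist_min i : (exists p, dipath_to i p) ->
  exists p, [/\ dipath_to i p, dist E e S i = (path_weight i p)%:E &
    forall q, dipath_to i q -> (path_weight i p <= path_weight i q)%R].
Proof.
case=> p0 /dipath_uniq[p1 [ip1 up1 _]].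
have size_le q : uniq (i :: q) -> (size q <= #|V|)%N.
  by move=> /card_uniqP/= h; rewrite ltnW// -h max_card.
pose P (b : #|V|.-bseq V) := dipath_to i b.
have P1 : P (Bseq (size_le _ up1)) by [].
case: (arg_minP (fun b : #|V|.-bseq V => path_weight i b) P1) => b Pb bmin.
have bmin' q : dipath_to i q -> (path_weight i b <= path_weight i q)%R.
  move=> /dipath_uniq[r [ir ur wr]]; apply: le_trans wr.
  exact: (bmin (Bseq (size_le _ ur))).
exists b; split=> //; apply/eqP; rewrite eq_le; apply/andP; split.
  by apply: ereal_inf_lbound; exists (bseqval b).
by apply: le_ereal_inf_tmp => _ [q iq <-]; rewrite lee_fin bmin'.
Qed.

Lemma dist_source i : i \in S -> dist E e S i = 0.
Proof.
move=> iS; apply/eqP; rewrite eq_le; apply/andP; split.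
  apply: ereal_inf_lbound; exists [::]; first by [].
  by rewrite /path_weight /= big_nil.
by apply: le_ereal_inf_tmp => _ [q iq <-]; rewrite lee_fin path_weight_ge0.
Qed.

End DistFacts.

Section Actions.
Variable V : finType.

Inductive action := Read of V & V | Update of V | Write of V & V.

Definition action_code (x : action) : (V * V) + (V + V * V) :=
  match x with
  | Read i j => inl (i, j)
  | Update i => inr (inl i)
  | Write i j => inr (inr (i, j))
  end.

Definition action_decode (x : (V * V) + (V + V * V)) : action :=
  match x with
  | inl (i, j) => Read i j
  | inr (inl i) => Update i
  | inr (inr (i, j)) => Write i j
  end.

Lemma action_codeK : cancel action_code action_decode.
Proof. by case. Qed.

HB.instance Definition _ := Equality.copy action (can_type action_codeK).

Definition is_read (x : action) := if x is Read _ _ then true else false.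
Definition is_update (x : action) := if x is Update _ then true else false.
Definition is_write (x : action) := if x is Write _ _ then true else false.

Definition scheduled (Rd : {set V * V}) (Up : {set V}) (Wr : {set V * V})
    (x : action) : bool :=
  match x with
  | Read i j => (i, j) \in Rd
  | Update i => i \in Up
  | Write i j => (i, j) \in Wr
  end.

Definition queue_of (Rd : {set V * V}) (Up : {set V}) (Wr : {set V * V})
    (q : seq action) : Prop :=
  uniq q /\ forall x, (x \in q) = scheduled Rd Up Wr x.

Definition all_before (A B : pred action) (q : seq action) : Prop :=
  forall x y, x \in q -> y \in q -> A x -> B y -> (index x q < index y q)%N.

(* n.-1.+1 is max(0, n - 1) + 1, the number of terms of a union over
   k = 0, ..., max(0, n - 1). *)
Definition bounded_asynchrony (E : {set V * V}) (PR PU PW : nat)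
    (Rd : nat -> {set V * V}) (Up : nat -> {set V}) (Wr : nat -> {set V * V})
    (Q : nat -> seq action) : Prop :=
  (1 <= PU)%N /\
  forall t, (1 <= t)%N ->
    [/\ \bigcup_(k < PR.-1.+1) Rd (t + k)%N = E,
        \bigcup_(k < PU) Up (t + k)%N = [set: V],
        \bigcup_(k < PW.-1.+1) Wr (t + k)%N = E,
        PW = 0%N -> all_before is_update is_write (Q t) /\
                    all_before is_write is_read (Q t) &
        PR = 0%N -> all_before (predC is_read) is_read (Q t)].

End Actions.

Section Algorithm.
Variables (R : realType) (V : finType).
Variables (E : {set V * V}) (e : V * V -> R) (S : {set V}).

(* st_m and st_dd are the families m_ij and d_ij; only their values on E are
   part of the state. *)
Record state := State {
  st_d : V -> \bar R;
  st_m : V * V -> \bar R;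
  st_dd : V * V -> \bar R }.

(* The entries lie in R together with +oo. *)
Definition proper_state (D : state) : Prop :=
  [/\ forall i, st_d D i != -oo,
      forall a, a \in E -> st_m D a != -oo &
      forall a, a \in E -> st_dd D a != -oo].

Definition exec1 (D : state) (x : action V) : state :=
  match x with
  | Read i j =>
      State (st_d D) (st_m D) [eta st_dd D with (i, j) |-> st_m D (i, j)]
  | Update i =>
      State [eta st_d D with i |->
               if i \in S then 0
               else \big[mine/+oo]_(j | (i, j) \in E)
                      (st_dd D (i, j) + (e (i, j))%:E)]
            (st_m D) (st_dd D)
  | Write i j =>
      State (st_d D) [eta st_m D with (i, j) |-> st_d D j] (st_dd D)
  end.

Fixpoint trajectory (D0 : state) (Q : nat -> seq (action V)) (t : nat)
    : state :=
  if t is t'.+1 then foldl exec1 (trajectory D0 Q t') (Q t) else D0.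

Local Notation dist := (dist E e S).

Definition underestimate_error (D : state) : \bar R :=
  maxe (\big[maxe/0]_(i : V) (dist i - st_d D i))
    (maxe (\big[maxe/0]_(a in E) (dist a.2 - st_m D a))
          (\big[maxe/0]_(a in E) (dist a.2 - st_dd D a))).

Definition underestimate_min (D : state) : \bar R :=
  mine (\big[mine/+oo]_(i : V | st_d D i < dist i) st_d D i)
    (mine (\big[mine/+oo]_(a in E | st_m D a < dist a.2) st_m D a)
          (\big[mine/+oo]_(a in E | st_dd D a < dist a.2) st_dd D a)).

End Algorithm.

(* er_map fixes -oo and +oo, whence the convention that the ceiling of -oo
   is -oo. *)
Definition eceil (R : realType) : \bar R -> \bar R :=
  er_map (fun x : R => (Num.ceil x)%:~R%R).

(* Main.v *)
(* Call c a floor of the state if every entry is at least the minimum of c and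
   its true value.  An update from entries with floor c yields an entry with
   floor c + e_min, because d*_i <= d*_j + e_ij.  Hence over P time steps the
   floor rises by e_min: first in all d_i (P_U steps), then through the writes
   in all m_ij (P_W steps), then through the reads in all d_ij (P_R steps).
   When P_W = 0 or P_R = 0, the order inside the queue makes the corresponding
   stage take place in the queue that completes the previous one.  The floor
   starts at D^min(0), and once it exceeds d*_max no entry is an
   underestimate. *)
Require Import Defs.
From HB Require Import structures.
From mathcomp Require Import all_boot all_order all_algebra.
From mathcomp Require Import classical_sets reals constructive_ereal ereal.

Set Implicit Arguments.
Unset Strict Implicit.
Unset Printing Implicit Defensive.

Import Order.TTheory GRing.Theory Num.Theory.

Local Open Scope ring_scope.
Local Open Scope ereal_scope.

(** * Order inside a queue *)

(** Without repetitions, every entry of [q2] has a larger index than [x]. This turns the conventions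
    for [PW = 0] and [PR = 0] into a restriction on the actions executed after [x]. *)
Lemma all_before_tail (V : finType) (A B : pred (action V)) q1 q2 x :
  uniq (q1 ++ x :: q2) -> all_before A B (q1 ++ x :: q2) -> B x ->
  {in q2, forall y, ~~ A y}.
Proof.
move=> uq hAB Bx y yq2; apply/negP => Ay.
have xq : x \in q1 ++ x :: q2 by rewrite mem_cat inE eqxx orbT.
have yq : y \in q1 ++ x :: q2 by rewrite mem_cat inE yq2 !orbT.
have := hAB _ _ yq xq Ay Bx.
move: uq; rewrite cat_uniq /= negb_or => /and3P[_ /andP[xq1 yq1] /andP[xq2 _]].
have yNx : x == y = false by apply/negP => /eqP xy; rewrite xy yq2 in xq2.
rewrite !index_cat (negPf xq1) (negPf (hasPn yq1 _ yq2)) /= yNx eqxx addn0.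
by rewrite ltnNge leq_addr.
Qed.

(** * Effect of one action on the floors *)

Section FloorInvariant.
Variables (R : realType) (V : finType).
Variables (E : {set V * V}) (e : V * V -> R) (S : {set V}).
(** Later [f] is the true distance and [w] the least weight; [f_edge] is the triangle inequality
    along an arc. *)
Variables (f : V -> \bar R) (w : R).
Hypothesis w_ge0 : (0 <= w)%R.
Hypothesis w_le : forall a, a \in E -> (w <= e a)%R.
Hypothesis f_source : forall i, i \in S -> f i = 0.
Hypothesis f_edge : forall i j, (i, j) \in E -> f i <= f j + (e (i, j))%:E.

Local Notation exec1 := (exec1 E e S).

Definition floor_d (c : \bar R) (D : state R V) :=
  forall i, mine (f i) c <= st_d D i.

Definition floor_m (c : \bar R) (D : state R V) :=
  forall a, a \in E -> mine (f a.2) c <= st_m D a.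

Definition floor_dd (c : \bar R) (D : state R V) :=
  forall a, a \in E -> mine (f a.2) c <= st_dd D a.

(** Three separate levels, because each stage of a cycle raises only one family. *)
Definition floors (c1 c2 c3 : \bar R) (D : state R V) :=
  [/\ floor_d c1 D, floor_m c2 D & floor_dd c3 D].

Lemma floor_le (c c' : \bar R) x y : c <= c' -> mine x c' <= y -> mine x c <= y.
Proof. by move=> cc'; apply: le_trans; rewrite le_min !ge_min lexx cc' orbT. Qed.

Lemma floor_update (c : \bar R) D i : floor_dd c D ->
  mine (f i) (c + w%:E) <= st_d (exec1 D (Update i)) i.
Proof.
move=> hD /=; rewrite eqxx; case: ifP => [iS|_].
  by rewrite f_source// ge_min lexx.
(* A vertex without out-arcs gets [+oo]. Otherwise each term is bounded according to which of [f j]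
   and [c] is smaller: by [f_edge] in the first case, by [w_le] in the second. *)
apply: le_bigmin => [|j ij]; first exact: leey.
apply: le_trans (leeD2r _ (hD _ ij)) => /=.
have [_|_] := leP (f j) c; first by rewrite ge_min f_edge.
by rewrite ge_min leeD2l ?orbT// lee_fin w_le.
Qed.

Lemma floor_write (c : \bar R) D i j : floor_d c D ->
  mine (f j) c <= st_m (exec1 D (Write i j)) (i, j).
Proof. by move=> hD /=; rewrite eqxx. Qed.

Lemma floor_read (c : \bar R) D i j : (i, j) \in E -> floor_m c D ->
  mine (f j) c <= st_dd (exec1 D (Read i j)) (i, j).
Proof. by move=> ij hD /=; rewrite eqxx; exact: (hD _ ij). Qed.

(** Stated for a single entry, as are its two analogues, so that a refreshed entry can be followed
    at its higher level while the rest of its family still waits. *)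
Lemma exec1_floor_d (c3 c : \bar R) D x i : c <= c3 + w%:E -> floor_dd c3 D ->
  mine (f i) c <= st_d D i -> mine (f i) c <= st_d (exec1 D x) i.
Proof.
move=> cc3 hD hi; case: x => [//|k|//].
have [->|ik] := eqVneq i k; first exact: floor_le cc3 (floor_update k hD).
by rewrite /= (negPf ik).
Qed.

Lemma exec1_floor_m (c1 c : \bar R) D x a : c <= c1 -> floor_d c1 D ->
  mine (f a.2) c <= st_m D a -> mine (f a.2) c <= st_m (exec1 D x) a.
Proof.
move=> cc1 hD ha; case: x => [//|//|k l].
have [->|ak] := eqVneq a (k, l); first exact: floor_le cc1 (floor_write k _ hD).
by rewrite /= (negPf ak).
Qed.

Lemma exec1_floor_dd (c2 c : \bar R) D x a : a \in E -> c <= c2 -> floor_m c2 D ->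
  mine (f a.2) c <= st_dd D a -> mine (f a.2) c <= st_dd (exec1 D x) a.
Proof.
move=> aE cc2 hD ha; case: x => [k l|//|//].
have [akl|ak] := eqVneq a (k, l); last by rewrite /= (negPf ak).
by rewrite akl in aE *; exact: floor_le cc2 (floor_read aE hD).
Qed.

(** The inequalities say that no family claims more than its input supplies: updates draw on
    [st_dd], writes on [st_d], reads on [st_m]. All level triples met during a cycle satisfy
    them. *)
Lemma exec1_floors (c1 c2 c3 : \bar R) D x :
  c1 <= c3 + w%:E -> c2 <= c1 -> c3 <= c2 ->
  floors c1 c2 c3 D -> floors c1 c2 c3 (exec1 D x).
Proof.
move=> h1 h2 h3 [hd hm hdd]; split=> [i|a aE|a aE].
- exact: exec1_floor_d h1 hdd _.
- by apply: exec1_floor_m h2 hd _; exact: hm.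
- by apply: exec1_floor_dd h3 hm _ => //; exact: hdd.
Qed.

Lemma foldl_inv (I : state R V -> Prop) q D :
  (forall D' y, y \in q -> I D' -> I (exec1 D' y)) -> I D ->
  I (foldl exec1 D q).
Proof.
elim: q D => //= y q IH D hI ID.
apply: IH; last by apply: hI; rewrite ?mem_head.
by move=> D' z zq; apply: hI; rewrite inE zq orbT.
Qed.

(** If no action of [q] can create [I], then [I] at the end of [q] must have held at its start. *)
Lemma foldl_back (I0 I : state R V -> Prop) q D :
  (forall D' y, I0 D' -> I0 (exec1 D' y)) ->
  (forall D' y, y \in q -> I0 D' -> I (exec1 D' y) -> I D') ->
  I0 D -> I (foldl exec1 D q) -> I D.
Proof.
move=> h0; elim: q D => //= y q IH D hI I0D Iq.
apply: (hI D y (mem_head y q) I0D).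
by apply: (IH _ _ (h0 _ _ I0D)) => // D' z zq; apply: hI; rewrite inE zq orbT.
Qed.

(** * Propagation along a trajectory *)

Section Trajectory.
Variables (D0 : state R V) (Q : nat -> seq (action V)).
Local Notation traj := (trajectory E e S D0 Q).

Lemma traj_inv (I : state R V -> Prop) s t :
  (forall D y, I D -> I (exec1 D y)) -> (s <= t)%N -> I (traj s) -> I (traj t).
Proof.
move=> hI /subnK <-; elim: (t - s)%N => // k IH Is.
by rewrite addSn /=; apply: foldl_inv (IH Is) => D y _; exact: hI.
Qed.

(** Used with [I] the floors already secured, [x] the action refreshing one entry, and [G] the
    raised floor of that entry. *)
Lemma traj_trigger (I G : state R V -> Prop) x s u t :
  (forall D y, I D -> I (exec1 D y)) ->
  (forall D y, I D -> G D -> G (exec1 D y)) ->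
  (forall D, I D -> G (exec1 D x)) ->
  I (traj s) -> (s < u <= t)%N -> x \in Q u -> G (traj t).
Proof.
move=> hI hG hx Is /andP[su ut] xQ.
have hIG D y : I D /\ G D -> I (exec1 D y) /\ G (exec1 D y).
  by move=> [ID GD]; split; [exact: hI|exact: hG].
suff [] : I (traj t) /\ G (traj t) by [].
apply: (traj_inv (I := fun D => I D /\ G D) hIG ut).
case: u su {ut} xQ => // u su; have Iu := traj_inv hI (ltnSE su) Is.
rewrite /=; case/splitPr => q1 q2; rewrite foldl_cat /=.
have I1 : I (foldl exec1 (traj u) q1).
  by apply: foldl_inv => // D y _; exact: hI.
apply: (foldl_inv (I := fun D => I D /\ G D)) => [D y _|]; first exact: hIG.
by split; [exact: hI|exact: hx].
Qed.

(* The trigger x may fire in the very queue that establishes I, provided that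
   the actions executed after x cannot be the ones that establish I. *)
Lemma traj_trigger_same (I0 I G : state R V -> Prop) x u t :
  (forall D y, I0 D -> I0 (exec1 D y)) ->
  (forall D y, I D -> I (exec1 D y)) ->
  (forall D y, I D -> G D -> G (exec1 D y)) ->
  (forall D, I D -> G (exec1 D x)) ->
  (forall q1 q2, Q u.+1 = q1 ++ x :: q2 -> forall D y, y \in x :: q2 ->
     I0 D -> I (exec1 D y) -> I D) ->
  I0 (traj u) -> I (traj u.+1) -> (u < t)%N -> x \in Q u.+1 -> G (traj t).
Proof.
move=> h0 hI hG hx hback I0u Iu ut xQ.
have hIG D y : I D /\ G D -> I (exec1 D y) /\ G (exec1 D y).
  by move=> [ID GD]; split; [exact: hI|exact: hG].
suff [] : I (traj t) /\ G (traj t) by [].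
apply: (traj_inv (I := fun D => I D /\ G D) hIG ut).
have [q1 [q2 Qu]] : exists q1 q2, Q u.+1 = q1 ++ x :: q2.
  by case/splitPr: xQ => q1 q2; exists q1, q2.
move: Iu; rewrite /= Qu foldl_cat /= => Iu.
have I01 : I0 (foldl exec1 (traj u) q1).
  by apply: foldl_inv => // D y _; exact: h0.
have I1 := foldl_back h0 (hback _ _ Qu) I01 Iu.
apply: (foldl_inv (I := fun D => I D /\ G D)) => [D y _|]; first exact: hIG.
by split; [exact: hI|exact: hx].
Qed.

(** * The three stages of a cycle and their iteration *)

Variables (Rd : nat -> {set V * V}) (Up : nat -> {set V}).
Variables (Wr : nat -> {set V * V}) (PR PU PW : nat).
Hypothesis hQ : forall t, (1 <= t)%N -> queue_of (Rd t) (Up t) (Wr t) (Q t).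
Hypothesis hA2 : bounded_asynchrony E PR PU PW Rd Up Wr Q.

Lemma floors_stage_update (c : \bar R) s :
  floors c c c (traj s) -> floors (c + w%:E) c c (traj (s + PU)).
Proof.
have cc' : c <= c + w%:E by rewrite leeDl ?lee_fin.
have hpres D y : floors c c c D -> floors c c c (exec1 D y).
  exact: exec1_floors.
move=> Is; have [_ hm hdd] := traj_inv hpres (leq_addr PU s) Is.
(* Queue [t] leads from time [t - 1] to time [t], so the window of queues after time [s] runs from
   [s + 1] to [s + PU]. *)
split=> // i; have [_ /(_ s.+1 isT)[_ hU _ _ _]] := hA2.
have : i \in [set: V] by rewrite inE.
rewrite -hU => /bigcupP[k _ iU].
apply: (traj_trigger (G := fun D => mine (f i) (c + w%:E) <= st_d D i)
  (x := Update i) (u := (s.+1 + k)%N) hpres _ _ Is).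
- by move=> D y [_ _ hD]; exact: exec1_floor_d hD.
- by move=> D [_ _ hD]; exact: floor_update.
- by rewrite addSn ltnS leq_addr /= -addnS leq_add2l.
- by have [_ ->] := hQ (ltn0Sn (s + k)).
Qed.

(** Time [s] precedes the queue that completes the updates. Its state matters when [PW = 0], where
    the writes act inside that very queue. *)
Lemma floors_stage_write (c : \bar R) s :
  floors c c c (traj s) -> floors (c + w%:E) c c (traj s.+1) ->
  floors (c + w%:E) (c + w%:E) c (traj (s.+1 + PW)).
Proof.
set c' := c + w%:E.
have cc' : c <= c' by rewrite leeDl ?lee_fin.
have hpres0 D y : floors c c c D -> floors c c c (exec1 D y).
  exact: exec1_floors.
have hpres D y : floors c' c c D -> floors c' c c (exec1 D y).
  exact: exec1_floors.
move=> I0s Is; have [hd _ hdd] := traj_inv hpres (leq_addr PW s.+1) Is.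
split=> // -[i j] aE.
pose G (D : state R V) := mine (f j) c' <= st_m D (i, j).
have hG D y : floors c' c c D -> G D -> G (exec1 D y).
  by move=> [hD _ _] GD; exact: (exec1_floor_m (a := (i, j)) y (lexx c') hD GD).
have hx D : floors c' c c D -> G (exec1 D (Write i j)).
  by move=> [hD _ _]; exact: floor_write.
change (G (traj (s.+1 + PW))); case: (posnP PW) => [PW0|PW_gt0].
- have [_ /(_ s.+1 isT)[_ _ hW]] := hA2.
  rewrite PW0 big_ord1 addn0 in hW * => /(_ erefl)[UW _] _.
  have [uq memq] := hQ (ltn0Sn s).
  apply: (traj_trigger_same hpres0 hpres hG hx _ I0s Is); rewrite ?addn0 ?memq ?hW//.
  (* From the write on, no action is an update, so none changes [st_d]: the raised floor of [st_d]
     was already there. *)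
  move=> q1 q2 Qs D y yq [_ hm hdd'] [hd' _ _]; split=> //.
  have : ~~ is_update y.
    move: yq; rewrite inE => /predU1P[->//|]; rewrite Qs in uq UW.
    exact: all_before_tail uq UW _ _.
  by case: y hd' {yq}.
(* For positive [PW] the window has [PW.-1.+1 = PW] queues and ends at [s.+1 + PW]. *)
- have [_ /(_ s.+2 isT)[_ _ hW _ _]] := hA2.
  have := aE; rewrite -{1}hW => /bigcupP[k _ ak].
  apply: (traj_trigger (u := (s.+2 + k)%N) hpres hG hx Is).
    rewrite addSn ltnS leq_addr /= -addnS leq_add2l.
    by rewrite -[leqRHS](prednK PW_gt0) ltn_ord.
  by have [_ ->] := hQ (ltn0Sn (s.+1 + k)).
Qed.

Lemma floors_stage_read (c : \bar R) s :
  floors c c c (traj s) -> floors (c + w%:E) (c + w%:E) c (traj s.+1) ->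
  floors (c + w%:E) (c + w%:E) (c + w%:E) (traj (s.+1 + PR)).
Proof.
set c' := c + w%:E.
have cc' : c <= c' by rewrite leeDl ?lee_fin.
have hpres0 D y : floors c c c D -> floors c c c (exec1 D y).
  exact: exec1_floors.
have hpres D y : floors c' c' c D -> floors c' c' c (exec1 D y).
  exact: exec1_floors.
move=> I0s Is; have [hd hm _] := traj_inv hpres (leq_addr PR s.+1) Is.
split=> // -[i j] aE.
pose G (D : state R V) := mine (f j) c' <= st_dd D (i, j).
have hG D y : floors c' c' c D -> G D -> G (exec1 D y).
  by move=> [_ hD _] GD; exact: (exec1_floor_dd (a := (i, j)) y aE (lexx c') hD GD).
have hx D : floors c' c' c D -> G (exec1 D (Read i j)).
  by move=> [_ hD _]; exact: floor_read.
change (G (traj (s.+1 + PR))); case: (posnP PR) => [PR0|PR_gt0].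
- have [_ /(_ s.+1 isT)[hR _ _ _]] := hA2.
  rewrite PR0 big_ord1 addn0 in hR * => /(_ erefl) UW.
  have [uq memq] := hQ (ltn0Sn s).
  apply: (traj_trigger_same hpres0 hpres hG hx _ I0s Is); rewrite ?addn0 ?memq ?hR//.
  (* From this read on, all actions are reads, which change neither [st_d] nor [st_m]. *)
  move=> q1 q2 Qs D y yq [_ _ hdd'] [hd' hm' _].
  have : is_read y.
    move: yq; rewrite inE => /predU1P[->//|yq]; rewrite Qs in uq UW.
    by have := all_before_tail uq UW isT yq; rewrite negbK.
  by case: y hd' hm' {yq} => // k l hd' hm' _; split.
- have [_ /(_ s.+2 isT)[hR _ _ _ _]] := hA2.
  have := aE; rewrite -{1}hR => /bigcupP[k _ ak].
  apply: (traj_trigger (u := (s.+2 + k)%N) hpres hG hx Is).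
    rewrite addSn ltnS leq_addr /= -addnS leq_add2l.
    by rewrite -[leqRHS](prednK PR_gt0) ltn_ord.
  by have [_ ->] := hQ (ltn0Sn (s.+1 + k)).
Qed.

Lemma floors_cycle (c : \bar R) s : floors c c c (traj s) ->
  floors (c + w%:E) (c + w%:E) (c + w%:E) (traj (s + (PR + PU + PW))).
Proof.
have cc' : c <= c + w%:E by rewrite leeDl ?lee_fin.
have hpres D y : floors c c c D -> floors c c c (exec1 D y).
  exact: exec1_floors.
move=> Is; have := floors_stage_update Is.
(* Writing [PU] as a successor exposes the last queue of the update stage, whose preceding state the
   next two stages refer to. *)
have [PU_gt0 _] := hA2; rewrite -(prednK PU_gt0) addnS => IU.
have := floors_stage_write (traj_inv hpres (leq_addr _ _) Is) IU.
rewrite addSn => IW.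
have := floors_stage_read (traj_inv hpres _ Is) IW.
rewrite -addnA leq_addr addnA => /(_ isT).
congr (floors _ _ _ (traj _)).
by rewrite addnS 2!addSn addnS -!addnA [(PR + _)%N]addnC -addnA.
Qed.

Lemma floors_cycles (c : \bar R) k t : floors c c c (traj 0) ->
  ((PR + PU + PW) * k <= t)%N ->
  let c' := c + (w *+ k)%:E in floors c' c' c' (traj t).
Proof.
move=> I0 kt c'; apply: traj_inv kt _ => [D y|].
  by apply: exec1_floors; rewrite ?lexx// leeDl ?lee_fin.
rewrite {}/c'; elim: k => [|k IH]; first by rewrite muln0 mulr0n adde0.
by have := floors_cycle IH; rewrite -addeA -EFinD -mulrSr -mulnSr.
Qed.

End Trajectory.
End FloorInvariant.

(** * True distances and the initial floor *)

Section Distances.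
Variables (R : realType) (V : finType).
Variables (E : {set V * V}) (e : V * V -> R) (S : {set V}).
Hypothesis e_gt0 : forall a, a \in E -> (0 < e a)%R.
Hypothesis reach : forall i, exists p, dipath_to E S i p.

Lemma dist_fin_num i : dist E e S i \is a fin_num.
Proof. by have [p [_ -> _]] := dist_min e_gt0 (reach i). Qed.

(** Prepend the arc to a shortest path from [j]. *)
Lemma dist_edge i j : (i, j) \in E ->
  dist E e S i <= dist E e S j + (e (i, j))%:E.
Proof.
move=> ij; have [p [jp -> _]] := dist_min e_gt0 (reach j).
rewrite -EFinD addrC -path_weight_cons.
apply: ereal_inf_lbound; exists (j :: p) => //.
by move: jp; rewrite /= /dipath_to /= ij.
Qed.

Lemma underestimate_error_eq0 D :
  (forall i, dist E e S i <= st_d D i) ->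
  (forall a, a \in E -> dist E e S a.2 <= st_m D a) ->
  (forall a, a \in E -> dist E e S a.2 <= st_dd D a) ->
  underestimate_error E e S D = 0.
Proof.
move=> hd hm hdd; rewrite /underestimate_error !bigmax_eq_id ?maxxx//.
- by move=> a aE; rewrite sube_le0; exact: hdd.
- by move=> a aE; rewrite sube_le0; exact: hm.
- by move=> i _; rewrite sube_le0; exact: hd.
Qed.

(** An entry either reaches its true value or is one of those over which the minimum is taken. *)
Lemma floors_underestimate_min D : let c := underestimate_min E e S D in
  floors E (dist E e S) c c c D.
Proof.
move=> c.
split=> [i|a aE|a aE]; rewrite ge_min; apply/orP.
- have [?|lt] := leP (dist E e S i) (st_d D i); [by left|right].
  by rewrite /c /underestimate_min ge_min bigmin_le_cond.
- have [?|lt] := leP (dist E e S a.2) (st_m D a); [by left|right].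
  rewrite /c /underestimate_min !ge_min.
  by rewrite [X in _ || (X || _)]bigmin_le_cond ?aE ?orbT.
- have [?|lt] := leP (dist E e S a.2) (st_dd D a); [by left|right].
  rewrite /c /underestimate_min !ge_min.
  by rewrite [X in _ || (_ || X)]bigmin_le_cond ?aE ?orbT.
Qed.

Lemma underestimate_min_gtNy D : proper_state E D ->
  -oo < underestimate_min E e S D.
Proof.
move=> [hd hm hdd]; rewrite /underestimate_min !lt_min.
by apply/and3P; split; apply: lt_bigmin => // a; first (by rewrite ltNye hd);
  case/andP=> ? _; rewrite ltNye ?hm ?hdd.
Qed.

End Distances.

(** * Counting the cycles *)

Theorem theorem3p6 (R : realType) (V : finType)
  (E : {set V * V}) (e : V * V -> R) (S : {set V})
  (he : forall a, a \in E -> (0 < e a)%R)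
  (hS : S \proper [set: V])
  (hA1 : forall i, exists p, dipath_to E S i p)
  (D0 : state R V) (hD0 : proper_state E D0)
  (Rd : nat -> {set V * V}) (Up : nat -> {set V}) (Wr : nat -> {set V * V})
  (Q : nat -> seq (action V))
  (hRd : forall t, (1 <= t)%N -> Rd t \subset E)
  (hWr : forall t, (1 <= t)%N -> Wr t \subset E)
  (hQ : forall t, (1 <= t)%N -> queue_of (Rd t) (Up t) (Wr t) (Q t))
  (PR PU PW : nat)
  (hA2 : bounded_asynchrony E PR PU PW Rd Up Wr Q) :
  let P := (PR + PU + PW)%N in
  let T := P%:R%:E *
    eceil ((dist_max E e S - underestimate_min E e S D0) / weight_min E e) in
  forall t : nat, T <= t%:R%:E ->
    underestimate_error E e S (trajectory E e S D0 Q t) = 0.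
Proof.
move=> P T t Tt.
(* A vertex outside [S] has a nontrivial path to [S], so an arc exists and the least weight is
   attained, hence finite. *)
have [_ [i0 _ i0S]] := properP hS.
have [a0 a0E] : exists a, a \in E.
  have [p] := hA1 i0; case: p => [|j p]; first by rewrite /dipath_to /= (negPf i0S).
  by rewrite /dipath_to /= -andbA => /andP[ij _]; exists (i0, j).
have [aw awE wE] : {a | a \in E & weight_min E e = (e a)%:E}.
  by apply: (eq_bigmin a0) => // a _; exact: leey.
have w_le a : a \in E -> (e aw <= e a)%R.
  by move=> aE; rewrite -lee_fin -wE; exact: bigmin_le_cond.
have [im _ dE] : {i | i \in V & dist_max E e S = dist E e S i}.
  by apply: (eq_bigmax i0) => // i _; exact: leNye.
have le_dmax i : dist E e S i <= dist_max E e S by exact: le_bigmax.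
move: Tt; rewrite {}/T wE; set w := e aw in wE w_le *.
have w_gt0 : (0 < w)%R by exact: he.
set M := underestimate_min E e S D0.
have IM : floors E (dist E e S) M M M (trajectory E e S D0 Q 0).
  exact: floors_underestimate_min.
(* It suffices to find a number [k] of full cycles that fits into time [t] and lifts the floor to
   [dist_max]. *)
suff key k : (P * k <= t)%N -> dist_max E e S <= M + (w *+ k)%:E ->
    underestimate_error E e S (trajectory E e S D0 Q t) = 0.
  have : -oo < M by exact: underestimate_min_gtNy.
  (* For [M = +oo] zero cycles suffice. *)
  case: M key {IM} => [m||] key _ //=; last first.
    by move=> _; apply: (key 0%N); rewrite ?muln0// leey.
  have := dist_fin_num he hA1 im; rewrite -dE => dfin.
  rewrite -(fineK dfin) in key *; set d := fine _ in key *.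
  rewrite -EFinB inver gt_eqF// -EFinM lee_fin.
  set z := Num.ceil _ => zt.
  (* Take [k] to be the ceiling, or 0 if the ceiling is negative. *)
  have [k zk Pk] : exists2 k : nat, (z <= k%:Z)%R & (P * k <= t)%N.
    case: z zt => n zt; last by exists 0%N; rewrite ?muln0.
    by exists n => //; rewrite -(ler_nat R) natrM.
  apply: key Pk _; rewrite -EFinD lee_fin -lerBlDl -mulr_natr mulrC -ler_pdivrMr//.
  by rewrite -[k%:R%R]/(k%:Z%:~R)%R -ceil_le_int.
move=> Pk dk.
have [hd hm hdd] := floors_cycles (ltW w_gt0) w_le (dist_source he)
  (dist_edge he hA1) hQ hA2 IM Pk.
(* Once the floor reaches [dist_max], truncating by it no longer affects any true distance. *)
have min_dist i : mine (dist E e S i) (M + (w *+ k)%:E) = dist E e S i.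
  by apply/min_idPl; exact: le_trans (le_dmax i) dk.
apply: underestimate_error_eq0 => [i|a aE|a aE].
- by rewrite -[leLHS]min_dist.
- by rewrite -[leLHS]min_dist; exact: hm.
- by rewrite -[leLHS]min_dist; exact: hdd.
Qed.
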